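(* $M'_k \leq \frac{4}{3}k + o(k)$ as $k \to \infty$; that is, for every $\epsilon>0$ there is $k^*$ such that for all $k\ge k^*$, every tournament $T$ on at least $2k+1$ vertices satisfies $\mathrm{sinv}'_k(T) \leq (\frac{4}{3}+\epsilon)k$.
   Context: A tournament is an orientation of a complete graph. For a digraph $D$ and $X \subseteq V(D)$, inverting $X$ means reversing the direction of every arc of $D$ with both endvertices in $X$. A digraph $D$ is $k$-arc-strong if for every partition $(V_1,V_2)$ of $V(D)$ into nonempty sets there are at least $k$ arcs from $V_1$ to $V_2$. $\mathrm{sinv}'_k(D)$ is the minimum number of sets whose successive inversion transforms $D$ into a $k$-arc-strong digraph. $M'_k = \max\{\mathrm{sinv}'_k(T) : T \text{ tournament of order at least } 2k+1\}$. *)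

(* Defs.v *)
From mathcomp Require Import all_boot.
From Stdlib Require Import Reals.
Set Implicit Arguments. Unset Strict Implicit. Unset Printing Implicit Defensive.

(* A digraph on a finite vertex type V is an arc relation D : rel V
   (D x y means there is an arc x -> y). *)

Definition is_tournament (V : finType) (D : rel V) : Prop :=
  (forall x, ~~ D x x) /\
  (forall x y, x != y -> (D x y (+) D y x)).

Definition invert (V : finType) (D : rel V) (X : {set V}) : rel V :=
  fun x y => if (x \in X) && (y \in X) then D y x else D x y.

Definition invert_seq (V : finType) (D : rel V) (Xs : seq {set V}) : rel V :=
  foldl (@invert V) D Xs.

Definition n_arcs (V : finType) (D : rel V) (V1 V2 : {set V}) : nat :=
  #|[set p : V * V | (p.1 \in V1) && (p.2 \in V2) && D p.1 p.2]|.

Definition arc_strong (V : finType) (k : nat) (D : rel V) : Prop :=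
  forall V1 : {set V}, V1 != set0 -> ~: V1 != set0 -> k <= n_arcs D V1 (~: V1).

(* sinv'_k(D) <= b  (sinv'_k(D) is the minimum number of sets whose successive
   inversion makes D k-arc-strong; it is <= b iff some such list of at most
   b sets exists). *)
Definition sinv'_le (V : finType) (k : nat) (D : rel V) (b : R) : Prop :=
  exists Xs : seq {set V}, (INR (size Xs) <= b)%R /\ arc_strong k (invert_seq D Xs).

(* Main.v *)
Require Import Defs.
From mathcomp Require Import all_boot all_order all_algebra zify.

(** Only [5/4 k + O(1)] inversions are needed. Deleting a vertex with in- and
    out-degree at least [k] is harmless, since inversions of the rest do not touch
    its arcs; a tournament without such vertices has at most [4k] vertices.  There
    we reach a near-regular tournament (every out-degree and in-degree differ by
    at most 1), which is [k]-arc-strong.  Let [P] be a set of [4 (k/8)] vertices.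
    Inverting a uniformly random set halves, up to an additive quadratic term, the
    expected sum of squared excesses outside [P]; so 16 inversions leave at most
    [k/8] vertices with excess above [k/8], and these are moved into [P].  Inverting
    [p |: A] and then [A] reverses just the arcs between [p] and [A], so [2 #|P|]
    inversions realise any reorientation of the arcs meeting [P].  One that balances
    all excesses exists: a vertex of excess at least 2 either starts a path of
    arcs meeting [P] whose reversal lowers the sum of squares, or its reachable
    set has positive total excess although no arc meeting [P] leaves it, which
    the small excesses outside [P] exclude. *)

Set Implicit Arguments. Unset Strict Implicit. Unset Printing Implicit Defensive.

Section Tournaments.

Import GRing.Theory Num.Theory Order.TTheory.
Local Open Scope ring_scope.

Variable V : finType.
Implicit Types (D : rel V) (A B C W P Q X : {set V}) (x y z : V).

(** * Excesses and net flows between vertex sets *)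

Definition sgn D x y : int := (D x y)%:Z - (D y x)%:Z.
(** Out-degree minus in-degree of [x], counted on the arcs between [x] and [W]; [x] itself may lie
    outside [W]. *)
Definition exc D W x : int := \sum_(y in W) sgn D x y.
Definition net D A B : int := \sum_(x in A) exc D B x.

Lemma sgnC D x y : sgn D y x = - sgn D x y.
Proof. by rewrite /sgn opprB. Qed.

Lemma sgnxx D x : sgn D x x = 0.
Proof. by rewrite /sgn subrr. Qed.

Lemma sgn_bound D x y : -1 <= sgn D x y <= 1.
Proof. by rewrite /sgn; case: (D x y); case: (D y x). Qed.

Lemma exc_ext D D' W x : (forall y, y \in W -> sgn D x y = sgn D' x y) ->
  exc D W x = exc D' W x.
Proof. by move=> h; apply: eq_bigr. Qed.

Lemma sgn_tournament D x y : is_tournament D -> x != y ->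
  D y x = ~~ D x y /\ sgn D x y = (D x y)%:Z *+ 2 - 1.
Proof.
move=> [_ tD] /tD; rewrite /sgn; case: (D x y); case: (D y x) => //=.
Qed.

Lemma sum_setU (F : V -> int) A B : [disjoint A & B] ->
  \sum_(x in A :|: B) F x = \sum_(x in A) F x + \sum_(x in B) F x.
Proof. by move=> dAB; rewrite -bigU //; apply: eq_bigl => x; rewrite !inE. Qed.

Lemma sum_setD (F : V -> int) A B : B \subset A ->
  \sum_(x in A :\: B) F x = \sum_(x in A) F x - \sum_(x in B) F x.
Proof.
move=> sBA; rewrite (big_setID B (A := A)) /=.
by rewrite (setIidPr sBA) addrC addrK.
Qed.

Lemma excD D A B x : B \subset A -> exc D (A :\: B) x = exc D A x - exc D B x.
Proof. exact: sum_setD. Qed.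

Lemma netC D A B : net D A B = - net D B A.
Proof.
rewrite /net /exc exchange_big /= -sumrN; apply: eq_bigr => y _.
by rewrite -sumrN; apply: eq_bigr => x _; rewrite sgnC.
Qed.

Lemma netxx D A : net D A A = 0.
Proof. have := netC D A A; lia. Qed.

Lemma netUl D A B C : [disjoint A & B] -> net D (A :|: B) C = net D A C + net D B C.
Proof. exact: sum_setU. Qed.

Lemma netDr D A B C : B \subset A -> net D C (A :\: B) = net D C A - net D C B.
Proof.
by move=> sBA; rewrite /net -sumrB; apply: eq_bigr => x _; rewrite excD.
Qed.

Lemma netUr D A B C : [disjoint A & B] -> net D C (A :|: B) = net D C A + net D C B.
Proof. by move=> dAB; rewrite netC netUl // (netC D C A) (netC D C B) opprD. Qed.

Lemma sum_le_const (F : V -> int) A c :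
  (forall x, x \in A -> F x <= c) -> \sum_(x in A) F x <= c * #|A|%:Z.
Proof.
move=> h; apply: le_trans (ler_sum _ h) _.
by rewrite sumr_const -mulr_natr natz.
Qed.

Lemma sum_ge_const (F : V -> int) A c :
  (forall x, x \in A -> c <= F x) -> c * #|A|%:Z <= \sum_(x in A) F x.
Proof.
move=> h; apply: le_trans _ (ler_sum _ h).
by rewrite sumr_const -mulr_natr natz.
Qed.

Lemma exc_bound D W x : - #|W|%:Z <= exc D W x <= #|W|%:Z.
Proof.
have h y := sgn_bound D x y; apply/andP; split.
- by rewrite -mulN1r; apply: sum_ge_const => y _; have /andP[] := h y.
- by rewrite -[X in _ <= X]mul1r; apply: sum_le_const => y _; have /andP[] := h y.
Qed.

Lemma net_to D A B : (forall x y, x \in A -> y \in B -> sgn D x y <= -1) ->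
  net D A B <= - (#|A|%:Z * #|B|%:Z).
Proof.
move=> h; have {h}h x : x \in A -> exc D B x <= - #|B|%:Z.
  by move=> xA; rewrite -mulN1r; apply: sum_le_const => y; apply: h.
by have := sum_le_const h; rewrite /net; lia.
Qed.

(** * Arcs across a cut, and arc-strength of near-regular tournaments *)

Lemma n_arcs_sum D A B :
  (n_arcs D A B)%:Z = \sum_(x in A) \sum_(y in B) (D x y)%:Z.
Proof.
rewrite pair_big_dep /= /n_arcs -sum1_card (raddf_sum Posz).
rewrite [RHS](bigID (fun p => D p.1 p.2)) /= [X in _ = _ + X]big1 ?addr0; last first.
  by move=> p /andP[_ /negbTE ->].
by apply: eq_big => [p|p]; rewrite !inE // => /andP[_ ->].
Qed.

(** The forward and backward arcs number [#|A| * #|B|] together, and their difference is the net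
    flow. *)
Lemma n_arcs_net D A B : is_tournament D -> [disjoint A & B] ->
  (n_arcs D A B)%:Z *+ 2 = #|A|%:Z * #|B|%:Z + net D A B.
Proof.
move=> tD dAB.
have -> : #|A|%:Z * #|B|%:Z = \sum_(x in A) \sum_(y in B) (1 : int).
  by rewrite !sumr_const natz -mulr_natr natz mulrC.
rewrite n_arcs_sum /net -big_split -sumrMnl; apply: eq_bigr => x xA.
rewrite /exc -big_split -sumrMnl; apply: eq_bigr => y yB /=.
have nxy : x != y by apply: contraTneq xA => ->; rewrite (disjointFl dAB yB).
by rewrite (sgn_tournament tD nxy).2; lia.
Qed.

Lemma n_arcs_sub D A B A' B' : A \subset A' -> B \subset B' ->
  (n_arcs D A B <= n_arcs D A' B')%N.
Proof.
move=> /subsetP sA /subsetP sB; apply/subset_leq_card/subsetP => p.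
by rewrite !inE => /andP[/andP[/sA -> /sB ->]].
Qed.

Lemma n_arcs_ext D D' A B : (forall x y, x \in A -> y \in B -> D x y = D' x y) ->
  n_arcs D A B = n_arcs D' A B.
Proof.
move=> h; apply: eq_card => p; rewrite !inE.
by case: (boolP (p.1 \in A)) => //= pA; case: (boolP (p.2 \in B)) => //= pB; rewrite h.
Qed.

(** Stated relative to a vertex set so that vertices can be deleted without changing the type
    [V]. *)
Definition arc_strong_on k D W : Prop :=
  forall A, A != set0 -> A \proper W -> (k <= n_arcs D A (W :\: A))%N.

(** If the two sides of a cut have [a] and [b] vertices, the net flow out of [A] is at least
    [- min(a, b)], since the excesses in [W] sum to 0. Hence twice the number of forward arcs is at
    least [a * b - min(a, b)]. *)
Lemma balanced_arc_strong k D W : is_tournament D -> (2 * k + 1 <= #|W|)%N ->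
  (forall x, x \in W -> -1 <= exc D W x <= 1) -> arc_strong_on k D W.
Proof.
move=> tD kW hW A A0 AW; have sAW := proper_sub AW.
have dA : [disjoint A & W :\: A].
  by rewrite -setI_eq0 setDE setICA setICr setI0.
have lo : - #|A|%:Z <= net D A W.
  by rewrite -mulN1r; apply: sum_ge_const => x /(subsetP sAW)/hW/andP[].
have hi : net D (W :\: A) W <= #|W :\: A|%:Z.
  rewrite -[X in _ <= X]mul1r; apply: sum_le_const => x.
  by rewrite inE => /andP[_ /hW/andP[]].
have e1 := n_arcs_net tD dA.
have e2 : net D A (W :\: A) = net D A W by rewrite netDr // netxx subr0.
have e3 : net D A W = - net D (W :\: A) W.
  have := netDr D (W :\: A) sAW; rewrite netxx (netC D _ A) e2; lia.
have := cardsD W A; rewrite (setIidPr sAW) => cD.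
have := proper_card AW; have := card_gt0 A; rewrite A0 => a0 aW.
have cs : #|W| = (#|A| + #|W :\: A|)%N by lia.
move: e1 lo hi kW a0 aW; rewrite e2 e3 cs mulr2n.
move: (net D _ W) (#|A|) (#|_ :\: _|) (n_arcs _ _ _) e2 e3 => v a b N _ _.
move=> e1 lo hi kW a0 aW.
(* This is [(c - 1) * (d - 2) >= 0]. It bounds twice the arc count below by
   [a + b - 2 >= 2 * k - 1], and parity then gives [k]. *)
have mul_ge c d : (0 < c)%N -> (c <= d)%N -> c%:Z * 2 + d%:Z <= c%:Z * d%:Z + 2.
  case: c => [|[|c]] //; case: d => [|[|d]] //; first by lia.
  by move=> _ _; have : 0 <= c%:Z * d%:Z by []; lia.
have [ab|ba] := leqP a b.
- by have := mul_ge _ _ a0 ab; lia.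
- have b0 : (0 < b)%N by lia.
  by have := mul_ge _ _ b0 (ltnW ba); lia.
Qed.

(** * Random inversions and the sum of squared excesses *)

Lemma invert_tournament D X : is_tournament D -> is_tournament (invert D X).
Proof.
move=> [ir tD]; split=> [x|x y nxy]; rewrite /invert; first by case: ifP.
by rewrite [(y \in X) && _]andbC; case: ifP => _; apply: tD => //; rewrite eq_sym.
Qed.

Lemma invert_seq_tournament D Xs : is_tournament D -> is_tournament (invert_seq D Xs).
Proof.
by elim: Xs D => //= X Xs IH D tD; apply/IH/invert_tournament.
Qed.

Lemma sgn_invert D X x y : sgn (invert D X) x y =
  if (x \in X) && (y \in X) then - sgn D x y else sgn D x y.
Proof. by rewrite /sgn /invert [(y \in X) && _]andbC; case: ifP => // _; lia. Qed.

(** The factor by which inverting [X] multiplies the sign of an arc between [y] and a vertex of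
    [X]. *)
Definition side X y : int := if y \in X then -1 else 1.
Definition toggle y X := if y \in X then X :\ y else y |: X.

Lemma toggleK y : involutive (toggle y).
Proof.
move=> X; rewrite /toggle; case: (boolP (y \in X)) => yX.
- by rewrite !inE eqxx /= setD1K.
- by rewrite !inE eqxx /= setU1K.
Qed.

Lemma in_toggle y X z : (z \in toggle y X) = (z \in X) (+) (z == y).
Proof.
rewrite /toggle; case: (boolP (y \in X)) => yX; rewrite !inE.
- by case: eqVneq => [->|] /=; rewrite ?yX ?addbF.
- by case: eqVneq => [->|] /=; rewrite ?(negbTE yX) ?addbF.
Qed.

(** Toggling [y] permutes the summation range and negates every term, so the sum equals its own
    negative. *)
Lemma sum_toggle_anti y (P : pred {set V}) (F : {set V} -> int) :
  (forall X, P (toggle y X) = P X) -> (forall X, F (toggle y X) = - F X) ->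
  \sum_(X | P X) F X = 0.
Proof.
move=> hP hF; suff : \sum_(X | P X) F X = - \sum_(X | P X) F X by lia.
rewrite {1}(reindex_inj (inv_inj (toggleK y))) /= -sumrN.
by apply: eq_big => X; rewrite ?hP ?hF.
Qed.

Lemma card_sets_mem x : #|[pred X : {set V} | x \in X]|%:Z *+ 2 = #|{set V}|%:Z.
Proof.
have e : #|[pred X : {set V} | x \in X]| = #|[pred X : {set V} | x \notin X]|.
  rewrite -!sum1_card (reindex_inj (inv_inj (toggleK x))) /=.
  by apply: eq_bigl => X; rewrite !inE in_toggle eqxx addbT.
have := cardC [pred X : {set V} | x \in X].
have <- : #|[pred X : {set V} | x \notin X]| = #|[predC [pred X : {set V} | x \in X]]|.
  by apply: eq_card => X; rewrite !inE.
by rewrite mulr2n -PoszD => <-; rewrite -e.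
Qed.

(** Second moment of a sum with random signs: after expanding the square, the mixed terms cancel
    under toggling and each diagonal term is at most 1. *)
Lemma sum_side_sqr x (s : V -> int) Q : s x = 0 -> (forall y, -1 <= s y <= 1) ->
  \sum_(X : {set V} | x \in X) (\sum_(y in Q) s y * side X y) ^+ 2
    <= #|[pred X : {set V} | x \in X]|%:Z * #|Q|%:Z.
Proof.
move=> sx sb.
under eq_bigr => X _ do rewrite expr2 big_distrlr /=.
rewrite exchange_big /=; apply: sum_le_const => y yQ.
rewrite exchange_big /= (bigD1 y yQ) /= [X in _ + X]big1 ?addr0 => [|z /andP[_ nzy]].
- rewrite -sum1_card (raddf_sum Posz) /=; apply: ler_sum => X _.
  by have := sb y; rewrite /side; case: ifP => _; nia.
(* Toggling [x] would violate the condition [x \in X]; this case vanishes because [s x = 0]. *)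
- have [eyx|nyx] := eqVneq y x.
    by apply: big1 => X _; rewrite eyx sx !mul0r.
  apply: (@sum_toggle_anti y) => X; first by rewrite in_toggle eq_sym (negbTE nyx) addbF.
  by rewrite /side !in_toggle eqxx addbT (negbTE nzy) addbF; case: (y \in X) => /=; lia.
Qed.

Definition energy D Q : int := \sum_(x in Q) exc D Q x ^+ 2.

Lemma exc_invert D X Q x : x \in Q -> exc (invert D (X :&: Q)) Q x =
  if x \in X then \sum_(y in Q) sgn D x y * side X y else exc D Q x.
Proof.
move=> xQ; case: ifP => xX; apply: eq_bigr => y yQ;
  by rewrite sgn_invert !inE xX xQ yQ /= ?andbT // /side; case: ifP => _; lia.
Qed.

(** Half of the sets [X] omit [x] and keep its excess. Over the other half its excess is a sum with
    random signs, whose mean square is at most [#|Q|]. *)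
Lemma mean_energy D Q :
  (\sum_(X : {set V}) energy (invert D (X :&: Q)) Q) *+ 2
    <= #|{set V}|%:Z * (energy D Q + #|Q|%:Z ^+ 2).
Proof.
rewrite /energy exchange_big /= -sumrMnl.
have -> : #|{set V}|%:Z * (\sum_(x in Q) exc D Q x ^+ 2 + #|Q|%:Z ^+ 2) =
    \sum_(x in Q) #|{set V}|%:Z * (exc D Q x ^+ 2 + #|Q|%:Z).
  by rewrite -mulr_sumr big_split /= sumr_const -mulr_natr natz expr2.
apply: ler_sum => x xQ.
rewrite (bigID (fun X : {set V} => x \in X)) /=.
under eq_bigr => X xX do rewrite exc_invert // xX.
under [X in _ + X]eq_bigr => X xX do rewrite exc_invert // (negbTE xX).
rewrite sumr_const.
have h := @sum_side_sqr x (sgn D x) Q (sgnxx D x) (sgn_bound D x).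
have e1 := card_sets_mem x.
have e2 := cardC [pred X : {set V} | x \in X].
have e3 : #|[pred X : {set V} | x \notin X]| = #|[predC [pred X : {set V} | x \in X]]|.
  by apply: eq_card => X; rewrite !inE.
move: h e1 e2; rewrite -{}e3 -[_ *+ #|_|]mulr_natr natz.
set a := #|[pred X : {set V} | x \in X]|.
set b := #|[pred X : {set V} | x \notin X]|.
set S := \sum_(_ | _) _; rewrite !mulr2n => h e1 e2.
have ab : b = a by apply/eqP; rewrite -(eqn_add2l a) e2 -eqz_nat -e1.
by rewrite -e1 ab; move: S a (exc _ _ _) (#|Q|) h {e1 e2 ab b} => S a e q; lia.
Qed.

Lemma halve_energy D Q :
  exists X, energy (invert D (X :&: Q)) Q *+ 2 <= energy D Q + #|Q|%:Z ^+ 2.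
Proof.
have [/existsP[X hX]|/existsPn h] := boolP [exists X,
  energy (invert D (X :&: Q)) Q *+ 2 <= energy D Q + #|Q|%:Z ^+ 2]; first by exists X.
have := mean_energy D Q.
rewrite -sumrMnl leNgt => /negP[].
set c := energy D Q + _.
have -> : #|{set V}|%:Z * c = \sum_(X : {set V}) c.
  by rewrite sumr_const -mulr_natl natz.
apply: ltr_sum => [|X _]; last by rewrite ltNge h.
by apply/hasP; exists set0; rewrite // mem_index_enum.
Qed.

Lemma energy_bound D Q : energy D Q <= #|Q|%:Z ^+ 3.
Proof.
rewrite exprSr; apply: sum_le_const => x _.
by have := exc_bound D Q x; move: (exc _ _ _) => e; nia.
Qed.

(** Each halving sends a bound [e] to [(e + q^2) / 2] with [q = #|Q|]; starting from [q^3], this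
    stays below [q^3 / 2^t + q^2]. *)
Lemma reduce_energy t D Q : exists Xs,
  [/\ size Xs = t,
      forall x y, ~~ ((x \in Q) && (y \in Q)) -> invert_seq D Xs x y = D x y
    & 2 ^+ t * energy (invert_seq D Xs) Q
        <= #|Q|%:Z ^+ 3 + 2 ^+ t * #|Q|%:Z ^+ 2].
Proof.
elim: t => [|t [Xs [sXs oXs hXs]]].
  exists [::]; split=> //; rewrite /= !expr0 !mul1r.
  by have := energy_bound D Q; move: (#|Q|) => q; nia.
have [X hX] := halve_energy (invert_seq D Xs) Q.
exists (rcons Xs (X :&: Q)); rewrite /invert_seq foldl_rcons -/(invert_seq _ _).
split=> [|x y nQ|]; first by rewrite size_rcons sXs.
  rewrite /invert !inE -oXs //; case: ifP => // /andP[/andP[_ xQ] /andP[_ yQ]].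
  by rewrite xQ yQ in nQ.
have p : 0 <= 2 ^+ t :> int by apply: exprn_ge0.
have := ler_wpM2l p hX; move: hXs; rewrite (exprS 2 t) mulr2n.
move: (2 ^+ t) (energy _ _) (energy _ _) (_ ^+ 3) (_ ^+ 2) => a b c d e; lia.
Qed.

(** * Prescribing all arcs at chosen vertices *)

Lemma replace_star D D' p : is_tournament D -> is_tournament D' ->
  exists Xs, size Xs = 2%N /\ forall x y, x != y -> invert_seq D Xs x y =
    if (x == p) || (y == p) then D' x y else D x y.
Proof.
move=> tD tD'; pose A := [set y | (y != p) && (D p y != D' p y)].
exists [:: p |: A; A]; split=> // x y nxy; rewrite /invert_seq /= /invert !inE.
have [nyx _] := sgn_tournament tD nxy; have [nyx' _] := sgn_tournament tD' nxy.
have [exp|nxp] /= := eqVneq x p; have [eyp|nyp] /= := eqVneq y p.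
- by rewrite exp eyp eqxx in nxy.
- by rewrite -exp nyx; case: (D x y); case: (D' x y).
- by rewrite -eyp nyx nyx'; case: (D x y); case: (D' x y).
- by case: (D p x != D' p x); case: (D p y != D' p y).
Qed.

(** Treat the vertices one at a time; an arc between two of them is set twice, both times as in
    [D']. *)
Lemma replace_stars D D' (ps : seq V) : is_tournament D -> is_tournament D' ->
  exists Xs, size Xs = (2 * size ps)%N /\ forall x y, x != y -> invert_seq D Xs x y =
    if (x \in ps) || (y \in ps) then D' x y else D x y.
Proof.
elim: ps D => [|p ps IH] D tD tD'; first by exists [::].
have [Xs [sXs hXs]] := replace_star p tD tD'.
have [Ys [sYs hYs]] := IH _ (invert_seq_tournament Xs tD) tD'.
exists (Xs ++ Ys); split=> [|x y nxy]; first by rewrite size_cat sXs sYs /=; lia.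
rewrite /invert_seq foldl_cat [LHS]hYs // hXs // !inE.
by case: (x == p); case: (y == p); case: (x \in ps); case: (y \in ps).
Qed.

(** * Path reversals and the balancing of excesses *)

Lemma exc_reverse_arc D W x y u : is_tournament D -> x \in W -> y \in W -> x != y ->
  D x y -> exc (invert D [set x; y]) W u =
    exc D W u - (u == x)%:Z *+ 2 + (u == y)%:Z *+ 2.
Proof.
move=> tD xW yW nxy Dxy.
have s1 : sgn D x y = 1 by rewrite (sgn_tournament tD nxy).2 Dxy.
have [->|nux] := eqVneq u x.
  rewrite (negbTE nxy) /exc (bigD1 y yW) [in RHS](bigD1 y yW) /=.
  rewrite sgn_invert !inE !eqxx orbT s1 /=.
  rewrite (@eq_bigr _ _ _ _ _ _ _ (sgn D x)); first by lia.
  move=> v /andP[_ nvy]; rewrite sgn_invert !inE (negbTE nvy) eqxx orbF /=.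
  by case: eqVneq => // ->; rewrite sgnxx.
have [->|nuy] := eqVneq u y.
  rewrite /exc (bigD1 x xW) [in RHS](bigD1 x xW) /=.
  rewrite sgn_invert !inE !eqxx orbT sgnC s1 /=.
  rewrite (@eq_bigr _ _ _ _ _ _ _ (sgn D y)); first by lia.
  move=> v /andP[_ nvx]; rewrite sgn_invert !inE (negbTE nvx) eqxx orbT /=.
  by case: eqVneq => // ->; rewrite sgnxx.
rewrite subr0 addr0; apply: exc_ext => v _.
by rewrite sgn_invert !inE (negbTE nux) (negbTE nuy).
Qed.

Section PathReversal.

(* [F] marks the pairs whose arc may be reversed. *)
Variables (W : {set V}) (F : rel V).
Hypothesis symF : symmetric F.
Hypothesis FW : forall x y, F x y -> (x \in W) && (y \in W).

Lemma reverse_path D x p : is_tournament D ->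
  path (fun u v => F u v && D u v) x p -> uniq (x :: p) ->
  exists D', [/\ is_tournament D',
    forall u v, ~~ F u v -> D' u v = D u v
    & forall u, exc D' W u = exc D W u - (u == x)%:Z *+ 2 + (u == last x p)%:Z *+ 2].
Proof.
elim: p D x => [|y p IH] D x tD.
  by move=> _ _; exists D; split=> // u /=; lia.
rewrite /= => /andP[/andP[Fxy Dxy] pth] /andP[]; rewrite inE negb_or.
move=> /andP[nxy xp] up; have /andP[xW yW] := FW Fxy.
(* The path has no repeated vertex, so its remaining arcs avoid [x] and survive the reversal of the
   first one. *)
have pth1 : path (fun u v => F u v && invert D [set x; y] u v) y p.
  have xyp : x \notin y :: p by rewrite inE negb_or nxy.
  move: pth; rewrite (@eq_in_path _ (fun z => z != x) _
    (fun u v => F u v && invert D [set x; y] u v)) //.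
  - move=> u v; rewrite !unfold_in => nux nvx; rewrite /invert !inE (negbTE nux) (negbTE nvx) /=.
    by case: ifP => // /andP[/eqP-> /eqP->].
  - by apply/allP => z zp; rewrite /=; apply: contraNneq xyp => <-.
have [D' [tD' oD' eD']] := IH _ y (invert_tournament [set x; y] tD) pth1 up.
exists D'; split=> // [u v nF|u]; last first.
  by rewrite eD' (exc_reverse_arc u tD xW yW nxy Dxy) addrK.
rewrite oD' // /invert !inE; case: ifP => // /andP[/orP[]/eqP eu /orP[]/eqP ev];
  move: nF; rewrite eu ev // ?Fxy // symF Fxy //.
Qed.

Lemma reverse_reachable D x y : is_tournament D -> x \in W -> y \in W ->
  connect (fun u v => F u v && D u v) x y -> exc D W y < exc D W x - 2 ->
  exists D', [/\ is_tournament D', forall u v, ~~ F u v -> D' u v = D u v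
    & energy D' W < energy D W].
Proof.
move=> tD xW yW /connectP[p0 pth0 ey] lt_yx.
case/shortenP: pth0 ey => p pth up _ ey.
have [D' [tD' oD' eD']] := reverse_path tD pth up.
have nxy : y != x by apply/eqP => exy; rewrite exy in lt_yx; lia.
exists D'; split=> //; rewrite /energy.
rewrite !(bigD1 x xW) /= !(bigD1 y (P := fun i => (i \in W) && (i != x))) ?yW //=.
rewrite (@eq_bigr _ _ _ _ _ _ (fun i => exc D' W i ^+ 2) (fun i => exc D W i ^+ 2)).
  rewrite !eD' -ey !eqxx (negbTE nxy) eq_sym (negbTE nxy).
  (* Only the endpoint excesses [a] and [b] change, to [a - 2] and [b + 2]; the sum of squares
     changes by [4 * (b - a + 2) < 0]. *)
  move: (\sum_(_ | _) _) lt_yx => S; move: (exc _ _ _) (exc _ _ _) => a b; nia.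
by move=> z /andP[/andP[_ nzx] nzy]; rewrite eD' -ey (negbTE nzx) (negbTE nzy); congr (_ ^+ 2); lia.
Qed.

End PathReversal.

(** Every arc meeting [P] between [X] and its complement enters [X]. Only arcs avoiding [P] can
    leave [X], and their net flow is at most [d] times the size of either side outside [P]. *)
Lemma net_closed_le0 D W P X (d : int) : is_tournament D -> P \subset W -> X \subset W ->
  d + d <= #|P|%:Z -> (forall q, q \in W :\: P -> - d <= exc D (W :\: P) q <= d) ->
  (forall x y, x \in X -> y \in W :\: X -> (x \in P) || (y \in P) -> ~~ D x y) ->
  net D X W <= 0.
Proof.
move=> tD sPW sXW dP dQ clX.
pose Y := W :\: X; pose Q := W :\: P.
have s_neg x y : x \in X -> y \in Y -> (x \in P) || (y \in P) -> sgn D x y <= -1.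
  move=> xX yY xyP; have nxy : x != y.
    by apply: contraTneq xX => ->; move: yY; rewrite inE => /andP[].
  by rewrite (sgn_tournament tD nxy).2 (negbTE (clX x y xX yY xyP)).
have h1 : net D (X :&: P) Y <= - (#|X :&: P|%:Z * #|Y|%:Z).
  by apply: net_to => x y; rewrite inE => /andP[xX xP] yY; apply: s_neg; rewrite // xP.
have h2 : net D (X :\: P) (Y :&: P) <= - (#|X :\: P|%:Z * #|Y :&: P|%:Z).
  apply: net_to => x y; rewrite in_setD [y \in _]inE => /andP[_ xX] /andP[yY yP].
  by apply: s_neg; rewrite // yP orbT.
have dX : [disjoint X :&: P & X :\: P].
  by rewrite -setI_eq0; apply/eqP/setP => z; rewrite !inE; case: (z \in P); rewrite ?andbF.
have dY : [disjoint Y :&: P & Y :\: P].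
  by rewrite -setI_eq0; apply/eqP/setP => z; rewrite !inE; case: (z \in P); rewrite ?andbF.
have e1 : net D X W =
    net D (X :&: P) Y + (net D (X :\: P) (Y :&: P) + net D (X :\: P) (Y :\: P)).
  rewrite -netUr // setID -netUl // setID /Y netDr // netxx subr0 //.
have eQ1 : Y :\: P = Q :\: (X :\: P).
  by apply/setP => z; rewrite !inE; case: (z \in P); rewrite ?andbF.
have sQ1 : X :\: P \subset Q by apply: setSD.
have sQ2 : Y :\: P \subset Q by apply/setSD/subsetDl.
have h3 : net D (X :\: P) (Y :\: P) = net D (X :\: P) Q.
  by rewrite eQ1 netDr // netxx subr0.
have h4 : net D (X :\: P) (Y :\: P) = - net D (Y :\: P) Q.
  rewrite netC; have -> : X :\: P = Q :\: (Y :\: P).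
    apply/setP => z; rewrite !inE; have := subsetP sXW z.
    by case: (z \in P); case: (z \in X); case: (z \in W) => //= /(_ isT).
  by rewrite netDr // netxx subr0.
have h5 : net D (X :\: P) Q <= d * #|X :\: P|%:Z.
  by apply: sum_le_const => x /(subsetP sQ1)/dQ/andP[].
have h6 : - d * #|Y :\: P|%:Z <= net D (Y :\: P) Q.
  by apply: sum_ge_const => x /(subsetP sQ2)/dQ/andP[].
have cP : #|P|%:Z = #|X :&: P|%:Z + #|Y :&: P|%:Z.
  rewrite -PoszD -(cardsID X P) setIC; congr (Posz (_ + #|pred_of_set _|)).
  apply/setP => z; rewrite !inE; have := subsetP sPW z.
  by case: (z \in P); case: (z \in X); case: (z \in W) => //= /(_ isT).
have cY := cardsID P Y.
move: dP; rewrite e1 cP; move: h1 h2 h5 h6; rewrite -h3 -cY PoszD.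
have -> : net D (Y :\: P) Q = - net D (X :\: P) (Y :\: P) by rewrite h4 opprK.
move: (net _ _ _) (net _ _ _) (net _ _ _) => n3 n2 n1.
move: (#|_ :&: _|) (#|_ :&: _|) (#|_ :\: _|) (#|_ :\: _|) => p2 p1 q1 q2.
move=> h1 h2 h5 h6 dP.
have m1 : 0 <= p1%:Z * p2%:Z by [].
have m2 : 0 <= p1%:Z * q2%:Z by [].
have m3 : 0 <= q1%:Z * p2%:Z by [].
(* As [p1 + p2 >= 2 * d], one of them is at least [d]. The arcs between that part of [P] and the
   opposite side outside [P] then outweigh the flow avoiding [P]. *)
have [c|c] := leP d p2%:Z.
- have : 0 <= q1%:Z * (p2%:Z - d) by apply: mulr_ge0; lia.
  lia.
- have : 0 <= q2%:Z * (p1%:Z - d) by apply: mulr_ge0; lia.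
  lia.
Qed.

Definition touching W P : rel V :=
  fun x y => [&& x \in W, y \in W & (x \in P) || (y \in P)].

Lemma lower_excess D W P (d : int) x : is_tournament D -> P \subset W ->
  d + d <= #|P|%:Z -> (forall q, q \in W :\: P -> - d <= exc D (W :\: P) q <= d) ->
  x \in W -> 1 < exc D W x ->
  exists D', [/\ is_tournament D', forall u v, ~~ touching W P u v -> D' u v = D u v
    & energy D' W < energy D W].
Proof.
move=> tD sPW dP dQ xW ex.
pose E := fun u v => touching W P u v && D u v.
have symF : symmetric (touching W P).
  by move=> u v; rewrite /touching andbCA orbC.
have FW u v : touching W P u v -> (u \in W) && (v \in W) by case/and3P=> -> ->.
pose X := [set y in W | connect E x y].
have sXW : X \subset W by apply/subsetP => z; rewrite inE => /andP[].
have xX : x \in X by rewrite inE xW connect0.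
have [/existsP[y /andP[yX lt_y]]|/existsPn h] :=
    boolP [exists y, (y \in X) && (exc D W y < exc D W x - 2)].
  move: yX; rewrite inE => /andP[yW cxy].
  exact: (reverse_reachable symF FW tD xW yW cxy lt_y).
(* All reachable vertices have excess at least [exc D W x - 2 >= 0], and that of [x] is positive. *)
have : 0 < net D X W.
  rewrite /net (bigD1 x xX) /=; apply: ltr_wpDr; last by lia.
  apply: sumr_ge0 => i /andP[iX _].
  by move: (h i); rewrite (iX : i \in X) /= -leNgt; lia.
rewrite ltNge => /negP[].
apply: (net_closed_le0 tD sPW sXW dP dQ) => u v uX vY uvP; apply/negP => Duv.
move: uX vY; rewrite !inE => /andP[uW xu] /andP[nv vW].
move: nv; rewrite vW /= => /negP[]; apply: connect_trans xu (connect1 _).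
by rewrite /E /touching uW vW uvP.
Qed.

Definition converse D : rel V := fun x y => D y x.

Lemma exc_converse D W x : exc (converse D) W x = - exc D W x.
Proof. by rewrite /exc -sumrN; apply: eq_bigr => y _; rewrite -sgnC. Qed.

Lemma energy_converse D W : energy (converse D) W = energy D W.
Proof. by apply: eq_bigr => x _; rewrite exc_converse sqrrN. Qed.

Lemma converse_tournament D : is_tournament D -> is_tournament (converse D).
Proof. by move=> [ir tD]; split=> // x y nxy; apply: tD; rewrite eq_sym. Qed.

(** Descent on the energy, a nonnegative integer. The hypothesis on [W :\: P] persists because no
    arc inside that set is changed. *)
Lemma balance_excess D W P (d : int) : is_tournament D -> P \subset W ->
  d + d <= #|P|%:Z -> (forall q, q \in W :\: P -> - d <= exc D (W :\: P) q <= d) ->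
  exists D', [/\ is_tournament D', forall u v, ~~ touching W P u v -> D' u v = D u v
    & forall x, x \in W -> -1 <= exc D' W x <= 1].
Proof.
move=> + sPW dP; have [n] := ubnP `|energy D W|%N.
elim: n D => // n IH D leD tD dQ.
have e_ge0 D0 : 0 <= energy D0 W by apply: sumr_ge0 => x _; apply: sqr_ge0.
have step D' : is_tournament D' -> (forall u v, ~~ touching W P u v -> D' u v = D u v) ->
    energy D' W < energy D W ->
    exists D', [/\ is_tournament D', forall u v, ~~ touching W P u v -> D' u v = D u v
    & forall x, x \in W -> -1 <= exc D' W x <= 1].
  move=> tD' oD' ltD'.
  have [||q qQ|D2 [tD2 oD2 bD2]] := IH D'; rewrite ?tD' //.
  - by have := e_ge0 D'; move: ltD' leD; lia.
  - have -> : exc D' (W :\: P) q = exc D (W :\: P) q; last exact: dQ.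
    apply: exc_ext => z zQ; move: qQ zQ; rewrite !inE => /andP[qP qW] /andP[zP zW].
    by rewrite /sgn !oD' // /touching (negbTE qP) (negbTE zP) !andbF.
  - by exists D2; split=> // u v nF; rewrite oD2 // oD'.
have [/existsP[x /andP[xW bx]]|/existsPn h] :=
    boolP [exists x, (x \in W) && ~~ (-1 <= exc D W x <= 1)]; last first.
  by exists D; split=> // x xW; have := h x; rewrite xW /= negbK.
have [ex|ex] := ltP 1 (exc D W x).
  by have [D' [tD' oD' ltD']] := lower_excess tD sPW dP dQ xW ex; apply: (step D').
(* An excess below -1 exceeds 1 in the converse tournament, which has the same energy. *)
have [||D' [tD' oD' ltD']] :=
    @lower_excess (converse D) W P d x (converse_tournament tD) sPW dP _ xW.
- by move=> q /dQ; rewrite exc_converse; lia.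
- by rewrite exc_converse; lia.
apply: (step (converse D')); first exact: converse_tournament.
- by move=> u v nF; rewrite /converse oD' //; move: nF; rewrite /touching andbCA orbC.
- by rewrite energy_converse -(energy_converse D).
Qed.

(** * Vertex sets of size at most [4 * k] *)

Lemma subset_of_card W m : (m <= #|W|)%N -> exists2 A : {set V}, A \subset W & #|A| = m.
Proof.
move=> mW; exists [set x in take m (enum W)].
  by apply/subsetP => x; rewrite inE => /mem_take; rewrite mem_enum.
rewrite cardsE; have /card_uniqP -> := take_uniq m (enum_uniq W).
by rewrite size_take -cardE; case: ltngtP mW.
Qed.

(* The base is a variable so that conversion never evaluates its powers. *)
Lemma cubic_contradiction (z c q : int) : z = 2 ->
  z ^+ 11 < c -> 0 <= q -> q <= z ^+ 5 * c ->
  z ^+ 16 * c ^+ 3 <= q ^+ 3 + z ^+ 16 * q ^+ 2 -> False.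
Proof.
move=> z2 c0 q0 qc; have z0 : 0 < z by rewrite z2.
have cp : 0 < c by apply: lt_trans c0; apply: exprn_gt0.
(* Here [q ^+ 3] is at most half of [z ^+ 16 * c ^+ 3], and [c > 2 ^ 11] puts [z ^+ 16 * q ^+ 2]
   strictly below the other half. *)
have h n : q ^+ n <= z ^+ (5 * n) * c ^+ n.
  rewrite exprM -exprMn; apply: lerXn2r qc; rewrite nnegrE //.
  by rewrite mulr_ge0 // ?exprn_ge0 // ltW.
have h2 := h 2%N; have h3 := h 3%N.
have h4 : 0 < z ^+ 15 * (c ^+ 2 * (c - z ^+ 11)).
  by rewrite mulr_gt0 ?exprn_gt0 // mulr_gt0 ?exprn_gt0 // subr_gt0.
have h5 : z ^+ 16 * q ^+ 2 <= z ^+ 15 * (c ^+ 2 * z ^+ 11).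
  apply: le_trans (ler_wpM2l _ h2) _; first by rewrite exprn_ge0 // ltW.
  have e : z ^+ 16 * z ^+ (5 * 2) = z ^+ 15 * z ^+ 11 by rewrite -!exprD.
  move: (c ^+ 2) => s; rewrite (mulrA (z ^+ 16)) e; move: (z ^+ 15) (z ^+ 11) => u v; lia.
rewrite {1}(exprS z 15) {1}z2; move: h3 h4 h5; rewrite mulrBr (exprSr c 2) -[(5 * 3)%N]/15%N.
move: (z ^+ 15) (c ^+ 2) (z ^+ 11) (q ^+ 3) => u s m r.
move: (_ * q ^+ 2) => w; lia.
Qed.

(** With [c = b + 1], at least [c] vertices of excess at least [c] in absolute value would give
    energy at least [c ^ 3], too much after 16 halvings. *)
Lemma few_unbalanced D Q (b : nat) : (2 ^ 11 <= b)%N -> (#|Q| <= 32 * b.+1)%N ->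
  2 ^+ 16 * energy D Q <= #|Q|%:Z ^+ 3 + 2 ^+ 16 * #|Q|%:Z ^+ 2 ->
  (#|[set x in Q | ~~ (- b%:Z <= exc D Q x <= b%:Z)%R]| <= b)%N.
Proof.
move=> b0 qb hE; set B := [set x in Q | _].
rewrite leqNgt; apply/negP => bB.
have sB : B \subset Q by apply/subsetP => x; rewrite inE => /andP[].
have hB : b.+1%:Z ^+ 2 * #|B|%:Z <= energy D Q.
  have : b.+1%:Z ^+ 2 * #|B|%:Z <= \sum_(x in B) exc D Q x ^+ 2.
    apply: sum_ge_const => x; rewrite inE => /andP[_].
    by move: (exc _ _ _) => e he; nia.
  move/le_trans; apply; rewrite /energy [X in _ <= X](big_setID B) /= (setIidPr sB).
  by rewrite lerDl; apply: sumr_ge0 => x _; apply: sqr_ge0.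
apply: (@cubic_contradiction 2 b.+1%:Z #|Q|%:Z) => //.
apply: le_trans hE; rewrite ler_pM2l // (exprSr _ 2); apply: le_trans hB.
by rewrite ler_wpM2l ?sqr_ge0.
Qed.

Lemma make_arc_strong_on k D W : is_tournament D -> (2 ^ 14 <= k)%N ->
  (2 * k + 1 <= #|W|)%N -> (#|W| <= 4 * k)%N -> exists Xs,
  [/\ (size Xs <= 16 + 10 * (k %/ 8))%N,
      forall x y, x != y -> ~~ ((x \in W) && (y \in W)) -> invert_seq D Xs x y = D x y
    & arc_strong_on k (invert_seq D Xs) W].
Proof.
move=> tD k0 kW Wk; set b := (k %/ 8)%N.
have b0 : (2 ^ 11 <= b)%N by rewrite leq_divRL // -(expnD 2 11 3).
have kb : (k < 8 * b.+1)%N by rewrite mulnC ltn_ceil.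
have bk : (8 * b <= k)%N by rewrite mulnC leq_trunc_div.
have [P0 sP0 cP0] : exists2 A : {set V}, A \subset W & #|A| = (4 * b)%N.
  by apply: subset_of_card; lia.
pose Q0 := W :\: P0.
have [Xs [sXs oXs hXs]] := reduce_energy 16 D Q0.
pose D1 := invert_seq D Xs; have tD1 : is_tournament D1 by apply: invert_seq_tournament.
have sQ0 : Q0 \subset W by apply: subsetDl.
have cQ0 := subset_leq_card sQ0.
have cQ32 : (#|Q0| <= 32 * b.+1)%N by lia.
have cB := few_unbalanced b0 cQ32 hXs.
set B := [set x in Q0 | _] in cB.
have sB : B \subset Q0 by apply/subsetP => x; rewrite inE => /andP[].
pose P := P0 :|: B.
have eQ : W :\: P = Q0 :\: B by rewrite setDDl.
have sPW : P \subset W by rewrite subUset sP0 (subset_trans sB).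
have cP4 : (4 * b <= #|P|)%N by rewrite -cP0 subset_leq_card // subsetUl.
have cP5 : (#|P| <= 5 * b)%N by have := cardsU P0 B; rewrite -/P cP0; lia.
(* Outside [B] the excess within [Q0] is at most [b] in absolute value, and removing the at most [b]
   vertices of [B] shifts it by at most [b]. So [d = 2 * b], and [P0] alone supplies the required
   [4 * b] vertices. *)
have [||D2 [tD2 oD2 bD2]] := @balance_excess D1 W P (2 * b)%N%:Z tD1 sPW.
- by lia.
- move=> q; rewrite eQ => qQ; rewrite excD //; have := exc_bound D1 B q.
  by move: qQ; rewrite !inE => /andP[+ qQ0]; rewrite qQ0 /= negbK -/D1; lia.
have [Ys [sYs oYs]] := replace_stars (enum P) tD1 tD2.
have e2 x y : x != y -> invert_seq D (Xs ++ Ys) x y = D2 x y.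
  move=> nxy; rewrite /invert_seq foldl_cat [LHS]oYs // !mem_enum.
  by case: ifP => // /negbT nP; rewrite oD2 // /touching (negbTE nP) !andbF.
exists (Xs ++ Ys); split=> [|x y nxy nW|].
(* 16 halvings, then two inversions for each of the at most [5 * b] vertices of [P]. *)
- by rewrite size_cat sXs sYs -cardE; lia.
- rewrite e2 // oD2; last by rewrite /touching andbA (negbTE nW).
  rewrite -oXs //; apply: contra nW => /andP[xQ yQ].
  by rewrite !(subsetP sQ0).
- move=> A A0 AW.
  have := balanced_arc_strong tD2 kW bD2 A0 AW.
  rewrite (@n_arcs_ext _ (invert_seq D (Xs ++ Ys))) // => x y xA.
  rewrite inE => /andP[yA _]; rewrite e2 //.
  by apply: contraNneq yA => <-.
Qed.

(** * Deleting vertices of large in- and out-degree *)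

Lemma few_low_outdegree k D W : is_tournament D ->
  (#|[set x in W | n_arcs D [set x] W < k]| <= 2 * k)%N.
Proof.
move=> tD; set Z := [set x in W | _].
(* Fewer than [k] out-arcs inside [Z] leave an excess of at most [2 * (k - 1) - (#|Z| - 1)]; the
   excesses within [Z] sum to 0, so this cannot be negative if [Z] is nonempty. *)
have h x : x \in Z -> exc D Z x <= (2 * k)%N%:Z - 1 - #|Z|%:Z.
  move=> xZ; have dx : [disjoint [set x] & Z :\ x] by rewrite disjoints1 !inE eqxx.
  have := n_arcs_net tD dx.
  have -> : net D [set x] (Z :\ x) = exc D Z x.
    by rewrite /net big_set1 excD ?sub1set // /exc big_set1 sgnxx subr0.
  have : (n_arcs D [set x] (Z :\ x) < k)%N.
    move: (xZ); rewrite inE => /andP[_]; apply: leq_ltn_trans; apply: n_arcs_sub => //.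
    by apply/subsetP => y; rewrite !inE => /andP[_ /andP[]].
  by have := cardsD1 x Z; rewrite xZ cards1; move: (#|_ :\ _|) => c; lia.
have := sum_le_const h; rewrite -/(net D Z Z) netxx; nia.
Qed.

Lemma n_arcs_converse D A B : n_arcs (converse D) A B = n_arcs D B A.
Proof.
by apply/eqP; rewrite -eqz_nat !n_arcs_sum exchange_big.
Qed.

(** The two cuts isolating [v] are handled by its degrees; any other cut of [W] restricts to a cut
    of [W :\ v], whose arcs also cross the original one. *)
Lemma arc_strong_on_add k D W v : v \in W ->
  (k <= n_arcs D [set v] W)%N -> (k <= n_arcs D W [set v])%N -> ~~ D v v ->
  arc_strong_on k D (W :\ v) -> arc_strong_on k D W.
Proof.
move=> vW outv inv irr sW A A0 AW; have sAW := proper_sub AW.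
have n_drop B C : (forall x y, x \in B -> y \in C -> D x y ->
    (x \in A) && (y \in W :\: A)) -> (n_arcs D B C <= n_arcs D A (W :\: A))%N.
  move=> h; apply/subset_leq_card/subsetP => p.
  by rewrite !inE => /andP[/andP[pB pC] Dp]; have := h _ _ pB pC Dp; rewrite !inE Dp andbT.
have [eA|nA] := eqVneq A [set v].
  apply: leq_trans outv (n_drop _ _ _) => x y; rewrite eA !inE => /eqP-> -> Dvy.
  by rewrite eqxx andbT /=; apply: contraNneq irr => ey; rewrite ey in Dvy.
have [eA|nA'] := eqVneq A (W :\ v).
  apply: leq_trans inv (n_drop _ _ _) => x y; rewrite eA !inE => xW /eqP-> Dxv.
  by rewrite xW vW eqxx !andbT; apply: contraNneq irr => ex; rewrite ex in Dxv.
apply: leq_trans (sW (A :\ v) _ _) _.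
- apply: contra nA => /eqP e; rewrite eqEsubset -setD_eq0 e eqxx /=.
  by rewrite sub1set; case/set0Pn: A0 => x xA; have := in_set0 x; rewrite -e !inE xA andbT;
    move/negbFE/eqP <-.
- rewrite properEneq setSD // andbT; apply: contra nA' => /eqP e.
  have [vA|vA] := boolP (v \in A).
    by move: AW; rewrite properEneq -(setD1K vA) e (setD1K vW) eqxx.
  rewrite -e; apply/eqP/setP => z; rewrite !inE.
  by case: eqVneq => // ->; rewrite (negbTE vA).
- apply: n_drop => x y; rewrite !inE => /andP[_ ->] /andP[+ /andP[yv ->]].
  by rewrite yv andbT.
Qed.

(** Induction on [#|W|]: at most [2 * k] vertices have low out-degree and at most [2 * k] low
    in-degree, so beyond [4 * k] vertices some [v] has neither defect and can be deleted. *)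
Lemma make_arc_strong_sub k D W : is_tournament D -> (2 ^ 14 <= k)%N ->
  (2 * k + 1 <= #|W|)%N -> exists Xs,
  [/\ (size Xs <= 16 + 10 * (k %/ 8))%N,
      forall x y, x != y -> ~~ ((x \in W) && (y \in W)) -> invert_seq D Xs x y = D x y
    & arc_strong_on k (invert_seq D Xs) W].
Proof.
move=> tD k0; have [n] := ubnP #|W|; elim: n W => // n IH W leW kW.
have [Wk|kW4] := leqP #|W| (4 * k)%N; first exact: make_arc_strong_on.
pose L := [set x in W | n_arcs D [set x] W < k]%N.
pose L' := [set x in W | n_arcs (converse D) [set x] W < k]%N.
have cL : (#|L| <= 2 * k)%N by apply: few_low_outdegree.
have cL' : (#|L'| <= 2 * k)%N by apply/few_low_outdegree/converse_tournament.
have [v] : exists v, v \in W :\: (L :|: L').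
  apply/set0Pn; rewrite -card_gt0 cardsD subn_gt0.
  apply: leq_ltn_trans (subset_leq_card (subsetIr _ _)) _.
  by have := cardsU L L'; lia.
rewrite !inE => /andP[/norP[+ +] vW]; rewrite vW /= -!leqNgt n_arcs_converse => outv inv.
have cW := cardsD1 v W; rewrite vW /= in cW.
have [||Xs [sXs oXs aXs]] := IH (W :\ v); [lia|lia|].
have off x y : x != y -> (x == v) || (y == v) -> invert_seq D Xs x y = D x y.
  by move=> nxy hv; apply: oXs => //; rewrite !inE; case/orP: hv => ->; rewrite ?andbF.
exists Xs; split=> // [x y nxy nW|].
  by apply: oXs => //; apply: contra nW; rewrite !inE => /andP[/andP[_ ->] /andP[_ ->]].
have [irX _] := invert_seq_tournament Xs tD.
(* The counts at [v] range over all of [W], including the pair [(v, v)], so the diagonal must agree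
   as well. *)
have loop x : invert_seq D Xs x x = D x x.
  by rewrite (negbTE (irX x)); case: tD => /(_ x)/negbTE->.
apply: (@arc_strong_on_add k _ W v) => //.
- rewrite (@n_arcs_ext _ D) // => x y; rewrite inE => /eqP-> _.
  by have [->|nvy] := eqVneq v y; [apply: loop | apply: off; rewrite ?eqxx].
- rewrite (@n_arcs_ext _ D) // => x y _; rewrite inE => /eqP->.
  by have [->|nxv] := eqVneq x v; [apply: loop | apply: off; rewrite ?eqxx ?orbT].
Qed.

End Tournaments.

From Stdlib Require Import Reals Lra.

Theorem theorem1p8 :
  forall eps : R, (0 < eps)%R ->
  exists kstar : nat, forall k : nat, kstar <= k ->
  forall (V : finType) (T : rel V),
    is_tournament T -> 2 * k + 1 <= #|V| ->
    sinv'_le k T ((4 / 3 + eps) * INR k)%R.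
Proof.
move=> eps eps0; exists (expn 2 14) => k k0 V T tT kV.
have [|Xs [sXs _ aXs]] := @make_arc_strong_sub V k T [set: V] tT k0.
  by rewrite cardsT.
exists Xs; split=> [|A A0 cA0].
- have bk : 8 * (k %/ 8) <= k by rewrite mulnC leq_trunc_div.
  (* The count is at most [16 + 5 * k / 4], and the slack [k / 12] up to [4 * k / 3] absorbs 16 as
     soon as [k >= 192]. *)
  have h : 3 * size Xs <= 4 * k by lia.
  have := le_INR _ _ (elimT leP h); rewrite -!multE !mult_INR !INR_IZR_INZ /= => {}h.
  have := Rmult_le_pos _ _ (Rlt_le _ _ eps0) (pos_INR k); rewrite INR_IZR_INZ; lra.
- rewrite -setTD; apply: aXs => //; rewrite properEneq subsetT andbT.
  by apply: contra cA0 => /eqP->; rewrite setCT.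
Qed.
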